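(* Let $\alpha\in(0,1)$, let $X$ be a metric space, let $Y\subset X$, and let $\pi:X\to X/\overline{Y}$ be the quotient map onto the metric quotient of $X$ by the closure $\overline{Y}$ of $Y$. (1) If $Y$ is $\alpha$-uniformly disconnected, then $\pi$ is $1$-Lipschitz and $Q$-light with $Q=9/\alpha+8$. (2) Conversely, if $\pi$ is $1$-Lipschitz and $Q$-light for some $Q>0$, then $Y$ is $\beta$-uniformly disconnected for every $\beta\in(0,1]$ with $\beta<1/Q$.
   Context: Metric quotient: for a metric space $(X,d)$ and a closed subset $E\subset X$, $X/E$ is the set of equivalence classes of the relation $x\sim y$ iff $x=y$ or $x,y\in E$, with the metric $\rho([a],[b])=\min\{d(a,b),\,d(a,E)+d(b,E)\}$ (convention: $d(a,\emptyset)=+\infty$, so $X/\emptyset=X$); the quotient map is $x\mapsto[x]$. For $\alpha\in(0,1]$, a finite sequence $x_0,\dots,x_m$ in a metric space is a relative $\alpha$-chain if $d(x_i,x_{i+1})\le\alpha\,d(x_0,x_m)$ for all $i<m$; it is nondegenerate if $x_0\ne x_m$. A metric space is $\alpha$-uniformly disconnected if it contains no nondegenerate relative $\alpha$-chain. For $\delta>0$, a $\delta$-chain is a finite sequence $x_0,\dots,x_m$ of points with $d(x_i,x_{i+1})\le\delta$ for all $i<m$. A set $U$ is $\delta$-connected if every pair of points of $U$ is contained in a $\delta$-chain in $U$; a $\delta$-component of a metric space is a maximal $\delta$-connected subset. A map $f:X\to Y$ between metric spaces is $Q$-light if, for every $r>0$ and every $E\subset Y$ with $\mathrm{diam}(E)\le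 r$, each $r$-component of $f^{-1}(E)$ has diameter at most $Qr$. *)

(* Defs.v *)
From HB Require Import structures.
From mathcomp Require Import all_boot all_order all_algebra.
From mathcomp Require Import all_classical all_reals all_analysis.

Set Implicit Arguments.
Unset Strict Implicit.
Unset Printing Implicit Defensive.

Import Order.TTheory GRing.Theory Num.Theory.

Local Open Scope classical_set_scope.
Local Open Scope ring_scope.

(* On a metric space, the library's extended pseudometric distance [edist] is
   the metric itself, and [edist_inf E a] is d(a, E), with d(a, set0) = +oo. *)
Section PointToSet.
Context {R : realType} {X : metricType R}.

Lemma edist_mdist (x y : X) : edist (x, y) = (mdist x y)%:E.
Proof.
apply/eqP; rewrite eq_le; apply/andP; split.
  apply/lee_addgt0Pr => e e0; rewrite -EFinD; apply: ereal_inf_lbound => /=.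
  exists (mdist x y + e) => //; split; first by rewrite ltr_wpDl ?mdist_ge0.
  by rewrite ballEmdist /= ltrDl.
apply: le_ereal_inf_tmp => _ /= [r [_]] + <-.
by rewrite ballEmdist /= lee_fin => /ltW.
Qed.

Lemma edist_infE (E : set X) (a : X) :
  edist_inf E a = ereal_inf [set (mdist a b)%:E | b in E].
Proof.
rewrite /edist_inf; congr ereal_inf; apply: eq_imagel => b _.
exact: edist_mdist.
Qed.

Lemma edist_inf_eq0 (E : set X) (a : X) :
  closed E -> edist_inf E a = 0%E -> E a.
Proof.
move=> cE a0; rewrite ((closure_id E).1 cE) => B /nbhs_ballP[e /= e0 aeB].
have : (ereal_inf [set (mdist a b)%:E | b in E] < e%:E)%E.
  by rewrite -edist_infE a0 lte_fin.
case/ereal_inf_lt => _ /= [b Eb <-]; rewrite lte_fin => ab.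
by exists b; split=> //; apply: aeB; rewrite ballEmdist.
Qed.

End PointToSet.

Section CollapseRelation.
Context {R : realType} {X : metricType R} (E : set X).

Definition collapse_op (x y : X) : bool := `[< x = y \/ (E x /\ E y) >].

Let collapse_refl : reflexive collapse_op.
Proof. by move=> x; apply/asboolP; left. Qed.

Let collapse_sym : symmetric collapse_op.
Proof.
by move=> x y; apply/asboolP/asboolP => -[->|[? ?]]; by [left | right].
Qed.

Let collapse_trans : transitive collapse_op.
Proof.
move=> y x z /asboolP[->//|[Ex Ey]] /asboolP[<-|[_ Ez]];
  by apply/asboolP; right.
Qed.

Definition collapse_rel := EquivRel _ collapse_refl collapse_sym collapse_trans.

(* min {d(a, b), d(a, E) + d(b, E)}, which is finite even when E = set0 *)
Definition collapse_dist (a b : X) : R :=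
  fine (mine (mdist a b)%:E (edist_inf E a + edist_inf E b)%E).

Lemma collapse_distE (a b : X) :
  (collapse_dist a b)%:E =
  mine (mdist a b)%:E (edist_inf E a + edist_inf E b)%E.
Proof.
rewrite /collapse_dist fineK// ge0_fin_numE ?gt_min ?ltry//.
by rewrite le_min lee_fin mdist_ge0 adde_ge0 ?edist_inf_ge0.
Qed.

Lemma collapse_dist_sym (a b : X) : collapse_dist a b = collapse_dist b a.
Proof. by rewrite /collapse_dist metric_sym addeC. Qed.

Lemma collapse_dist_triangle (b a c : X) :
  collapse_dist a c <= collapse_dist a b + collapse_dist b c.
Proof.
rewrite -lee_fin EFinD !collapse_distE.
have tri x y : (edist_inf E x <= (mdist x y)%:E + edist_inf E y)%E.
  by rewrite -edist_mdist edist_inf_triangle.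
have [_|_] := leP (mdist a b)%:E; have [_|_] := leP (mdist b c)%:E;
  rewrite ge_min.
- by rewrite -EFinD lee_fin metric_triangle.
- by rewrite addeA (leeD _ (lexx _)) ?orbT// tri.
- by rewrite -addeA (leeD (lexx _)) ?orbT// addeC metric_sym tri.
- by rewrite orbC leeD// ?leeDl ?leeDr ?edist_inf_ge0.
Qed.

Let collapse_dist_pil (a a' b : X) :
  collapse_op a a' -> collapse_dist a b = collapse_dist a' b.
Proof.
have dE x : E x -> collapse_dist x b = fine (edist_inf E b).
  move=> Ex; rewrite /collapse_dist (edist_inf0 Ex) add0e min_r//.
  rewrite -edist_mdist edist_sym -[leRHS]adde0 -(edist_inf0 Ex).
  exact: edist_inf_triangle.
by move=> /asboolP[->//|[Ea Ea']]; rewrite !dE.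
Qed.

Lemma collapse_dist_pi (a a' b b' : X) :
  collapse_op a a' -> collapse_op b b' ->
  collapse_dist a b = collapse_dist a' b'.
Proof.
move=> aa' bb'; rewrite (collapse_dist_pil _ aa') collapse_dist_sym.
by rewrite (collapse_dist_pil _ bb') collapse_dist_sym.
Qed.

Lemma collapse_dist0 (a b : X) :
  closed E -> collapse_dist a b = 0 -> collapse_op a b.
Proof.
move=> cE ab0; have := collapse_distE a b; rewrite ab0; have [_|_] := leP.
  by move=> [ab]; rewrite (mdist_positivity _ _ (esym ab)); apply/asboolP; left.
move=> /esym/eqP; rewrite padde_eq0 ?edist_inf_ge0// => /andP[/eqP a0 /eqP b0].
by apply/asboolP; right; split; exact: edist_inf_eq0.
Qed.

End CollapseRelation.

(* The proof that E is closed is a parameter of the type X/E, as it is needed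
   for the distance of X/E to separate points. *)
Definition metric_quotient {R : realType} {X : metricType R} {E : set X}
  (cE : closed E) : Type := {eq_quot (collapse_rel E)}%qT.

Section MetricQuotient.
Context {R : realType} {X : metricType R} {E : set X} (cE : closed E).
Local Open Scope quotient_scope.
Local Notation metric_quotient := (metric_quotient cE).

HB.instance Definition _ :=
  EqQuotient.copy metric_quotient {eq_quot (collapse_rel E)}.
HB.instance Definition _ :=
  Choice.copy metric_quotient {eq_quot (collapse_rel E)}.

Definition quotient_map (x : X) : metric_quotient := \pi x.

Let rho (p q : metric_quotient) : R := collapse_dist E (repr p) (repr q).

Let rho_xx (p : metric_quotient) : rho p p = 0.
Proof.
apply: EFin_inj; rewrite collapse_distE mdistxx min_l//.
by rewrite adde_ge0// edist_inf_ge0.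
Qed.

Let rho_positivity (p q : metric_quotient) : rho p q = 0 -> p = q.
Proof.
move=> /(collapse_dist0 cE) pq; rewrite -[p]reprK -[q]reprK.
exact/(@eqmodP _ (collapse_rel E)).
Qed.

Let rho_sym (p q : metric_quotient) : rho p q = rho q p.
Proof. exact: collapse_dist_sym. Qed.

Let rho_triangle (q p r : metric_quotient) : rho p r <= rho p q + rho q r.
Proof. exact: collapse_dist_triangle. Qed.

HB.instance Definition _ := @isMetric.Build R metric_quotient
  rho rho_xx rho_positivity rho_sym rho_triangle.

Lemma quotient_map_eq (a b : X) :
  quotient_map a = quotient_map b <-> a = b \/ (E a /\ E b).
Proof.
by split=> [/(@eqmodP _ (collapse_rel E))/asboolP//|ab];
  apply/(@eqmodP _ (collapse_rel E))/asboolP.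
Qed.

Lemma mdist_quotient_map (a b : X) :
  (mdist (quotient_map a) (quotient_map b))%:E =
  mine (mdist a b)%:E (edist_inf E a + edist_inf E b)%E.
Proof.
rewrite -collapse_distE; congr EFin.
by apply: collapse_dist_pi; apply/(@eqmodP _ (collapse_rel E)); rewrite reprK.
Qed.

End MetricQuotient.

Section Chains.
Context {R : realType} {X : metricType R}.
Implicit Types (A C U : set X) (x y z : X) (s : seq X).

(* The finite sequence x_0, ..., x_m is given by its head x_0 = x and its tail
   s, so that x_m = last x s. *)
Definition delta_chain (delta : R) x s : bool :=
  path (fun y z => mdist y z <= delta) x s.

Definition relative_chain (alpha : R) x s : bool :=
  path (fun y z => mdist y z <= alpha * mdist x (last x s)) x s.

Definition nondegenerate x s : bool := x != last x s.

(* A, as a metric space for the restricted distance, is alpha-uniformly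
   disconnected *)
Definition uniformly_disconnected (alpha : R) A : Prop :=
  ~ exists x s, [/\ [set` x :: s] `<=` A, relative_chain alpha x s &
                    nondegenerate x s].

Definition delta_connected (delta : R) U : Prop :=
  forall x y, U x -> U y ->
  exists z s, [/\ [set` z :: s] `<=` U, delta_chain delta z s,
                  x \in z :: s & y \in z :: s].

Definition delta_component (delta : R) A C : Prop :=
  [/\ C `<=` A, delta_connected delta C &
      forall U, U `<=` A -> delta_connected delta U -> C `<=` U -> U = C].

(* The supremum is taken in [0, +oo], so that diam set0 = 0. *)
Definition diam A : \bar R :=
  maxe 0%E (ereal_sup [set (mdist p.1 p.2)%:E | p in A `*` A]).

End Chains.

Section Maps.
Context {R : realType} {X Y : metricType R}.

(* The library's [k.-lipschitz f] is only available on normed modules. *)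
Definition metric_lipschitz (k : R) (f : X -> Y) : Prop :=
  forall x y, mdist (f x) (f y) <= k * mdist x y.

Definition light (Q : R) (f : X -> Y) : Prop :=
  forall (r : R) (E : set Y), 0 < r -> (diam E <= r%:E)%E ->
  forall C : set X, delta_component r (f @^-1` E) C ->
  (diam C <= (Q * r)%:E)%E.

End Maps.

(* Main.v *)
Require Import Defs.
From mathcomp Require Import all_boot all_order all_algebra.
From mathcomp Require Import all_classical all_reals all_analysis.
From mathcomp Require Import lra.

(** (1) Let [p], [q] be joined by an [r]-chain on which [pi] varies by at most
    [r], and suppose that [mdist p q > Q * r].  Since [pi p] and [pi q] are
    [r]-close, [p] is within [r] of the closure of [Y], so every point of the
    chain is within [3 * r] of a point of [Y].  Moving each point to such a
    neighbour gives a [7 * r]-chain in [Y] whose endpoints are at distance more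
    than [9 * r / alpha], hence a relative [alpha]-chain.
    (2) The closure of [Y] is a fibre of [pi], so a relative [beta]-chain in [Y]
    of span [D] lies in a [beta * D]-component of a fibre, whose diameter is at
    most [Q * beta * D < D]. *)

Import Order.TTheory GRing.Theory Num.Theory.

Local Open Scope classical_set_scope.
Local Open Scope ring_scope.

Lemma last_rev_belast {T : Type} (x : T) (s : seq T) :
  last (last x s) (rev (belast x s)) = x.
Proof. by case: s => //= y s; rewrite rev_cons last_rcons. Qed.

Section Diameter.
Context {R : realType} {X : metricType R}.
Implicit Types (A : set X) (x y : X).

Lemma diam_le A (c : R) : 0 <= c ->
  (forall x y, A x -> A y -> mdist x y <= c) -> (diam A <= c%:E)%E.
Proof.
move=> c0 Ac; rewrite /diam ge_max lee_fin c0 /=.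
apply: ge_ereal_sup => _ [[x y] [/= Ax Ay]] <-.
by rewrite lee_fin Ac.
Qed.

Lemma mdist_le_diam A (c : R) x y :
  (diam A <= c%:E)%E -> A x -> A y -> mdist x y <= c.
Proof.
rewrite /diam ge_max => /andP[_ Ac] Ax Ay; rewrite -lee_fin.
by apply: le_trans Ac; apply: ereal_sup_ubound; exists (x, y).
Qed.

End Diameter.

Section ChainJoined.
Context {R : realType} {X : metricType R}.
Implicit Types (delta : R) (A C U : set X) (x y z : X) (s : seq X).

(** Pinning both endpoints makes this an equivalence relation on [A], whereas [delta_connected] only
    asks that the two points occur somewhere in a common chain. *)
Definition chain_joined delta A x y :=
  exists s, [/\ [set` x :: s] `<=` A, delta_chain delta x s & last x s = y].

Lemma chain_joined_refl {delta A x} : A x -> chain_joined delta A x x.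
Proof. by move=> Ax; exists [::]; split=> // z /=; rewrite inE => /eqP->. Qed.

Lemma chain_joined_sub {delta A C x y} :
  A `<=` C -> chain_joined delta A x y -> chain_joined delta C x y.
Proof. by move=> AC [s [sA ? ?]]; exists s; split=> // z /sA/AC. Qed.

Lemma chain_joined_sym {delta A x y} :
  chain_joined delta A x y -> chain_joined delta A y x.
Proof.
move=> [s [sA xs xsy]]; exists (rev (belast x s)); split.
- move=> z /=; rewrite -xsy -rev_rcons -lastI mem_rev; exact: sA.
- rewrite -xsy /delta_chain rev_path.
  by under eq_path do rewrite metric_sym.
- by rewrite -xsy last_rev_belast.
Qed.

Lemma chain_joined_trans {delta A x y z} :
  chain_joined delta A x y -> chain_joined delta A y z ->
  chain_joined delta A x z.
Proof.
move=> [s [sA xs xsy]] [t [tA yt ytz]]; exists (s ++ t); split.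
- move=> w /=; rewrite -cat_cons mem_cat => /orP[/sA//|wt].
  by apply: tA; rewrite /= inE wt orbT.
- by rewrite /delta_chain cat_path xsy; apply/andP.
- by rewrite last_cat xsy.
Qed.

Lemma chain_joined_mem {delta A x s y} : [set` x :: s] `<=` A ->
  delta_chain delta x s -> y \in x :: s -> chain_joined delta A x y.
Proof.
move=> sA xs ys; case/splitPl: ys sA xs => s1 s2 s1y sA.
rewrite /delta_chain cat_path => /andP[xs1 _]; exists s1; split=> // w ws1.
by apply: sA; rewrite /= -cat_cons mem_cat ws1.
Qed.

(** The given chain starts at some [z] and meets [x] and [y] in either order, so go back from [x] to
    [z], then forward to [y]. *)
Lemma delta_connected_joined {delta U x y} :
  delta_connected delta U -> U x -> U y -> chain_joined delta U x y.
Proof.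
move=> Uc Ux Uy; have [z [s [sU zs xs ys]]] := Uc _ _ Ux Uy.
apply: chain_joined_trans (chain_joined_mem sU zs ys).
exact: chain_joined_sym (chain_joined_mem sU zs xs).
Qed.

(** Supplies a component through [x], to which lightness can be applied. It is maximal because a
    [delta]-connected set containing it contains [x], to which all its points are then joined. *)
Lemma delta_component_joined delta A x :
  A x -> delta_component delta A [set y | chain_joined delta A x y].
Proof.
move=> Ax; split.
- by move=> _ [s [sA _ <-]]; apply: sA; exact: mem_last.
- move=> y z xy xz.
  have [s [sA ys ysz]] := chain_joined_trans (chain_joined_sym xy) xz.
  exists y, s; split=> //; last 2 first.
  + by rewrite mem_head.
  + by rewrite -ysz mem_last.
  + by move=> w ws /=; exact: chain_joined_trans xy (chain_joined_mem sA ys ws).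
- move=> U UA Uc CU; apply/seteqP; split=> // y Uy /=.
  apply: chain_joined_sub UA _; apply: delta_connected_joined Uc _ Uy.
  by apply: CU; exact: chain_joined_refl.
Qed.

End ChainJoined.

Section Quotient.
Context {R : realType} {X : metricType R} (Y : set X).
Local Notation pi := (quotient_map (@closed_closure X Y)).

Lemma edist_inf_closure_lt (a : X) (c : R) :
  (edist_inf (closure Y) a < c%:E)%E -> exists2 y, Y y & mdist a y < c.
Proof.
rewrite edist_infE => /ereal_inf_lt[_ [b cYb <-]]; rewrite lte_fin => abc.
(* The strict inequality leaves room to move from [b] in the closure to a point of [Y]. *)
have [|y [Yy]] := cYb (ball b (c - mdist a b)).
  by apply: nbhsx_ballx; rewrite subr_gt0.
rewrite ballEmdist /= => byc; exists y => //.
by have := metric_triangle a b y; lra.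
Qed.

Lemma metric_lipschitz_quotient_map : metric_lipschitz 1 pi.
Proof. by move=> a b; rewrite mul1r -lee_fin mdist_quotient_map ge_min lexx. Qed.

Lemma mdist_quotient_map_le (a b : X) (r : R) : mdist (pi a) (pi b) <= r ->
  mdist a b <= r \/
  (edist_inf (closure Y) a + edist_inf (closure Y) b <= r%:E)%E.
Proof.
by rewrite -lee_fin mdist_quotient_map ge_min lee_fin => /orP.
Qed.

(** Either [x] is [r]-close to [p], whose neighbour in [Y] at distance below [2 * r] then serves, or
    [x] is itself within [r] of the closure. *)
Lemma near_of_quotient_close (r : R) (p q x : X) : 0 < r -> r < mdist p q ->
  mdist (pi p) (pi q) <= r -> mdist (pi x) (pi p) <= r ->
  exists2 y, Y y & mdist x y <= 3 * r.
Proof.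
move=> r0 rpq /mdist_quotient_map_le[|pqr]; first by rewrite leNgt rpq.
have [y Yy py] : exists2 y, Y y & mdist p y < 2 * r.
  apply: edist_inf_closure_lt; apply: (@le_lt_trans _ _ r%:E).
    by apply: le_trans pqr; rewrite leeDl// edist_inf_ge0.
  by rewrite lte_fin; lra.
move=> /mdist_quotient_map_le[xp|xpr].
  by exists y => //; have := metric_triangle x p y; lra.
have [z Yz xz] : exists2 z, Y z & mdist x z < 3 * r.
  apply: edist_inf_closure_lt; apply: (@le_lt_trans _ _ r%:E).
    by apply: le_trans xpr; rewrite leeDl// edist_inf_ge0.
  by rewrite lte_fin; lra.
by exists z => //; exact: ltW.
Qed.

Lemma light_quotient_map (alpha : R) : 0 < alpha ->
  uniformly_disconnected alpha Y -> light (9 / alpha + 8) pi.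
Proof.
move=> a0 udY r E r0 Er C [CE Cc _].
have Qr0 : 0 < 9 / alpha * r by rewrite mulr_gt0// divr_gt0.
apply: diam_le => [|p q Cp Cq]; first by rewrite mulrDl; lra.
rewrite leNgt; apply/negP => Qpq; apply: udY.
have rE x y : C x -> C y -> mdist (pi x) (pi y) <= r.
  by move=> /CE Ex /CE Ey; exact: mdist_le_diam Er _ _.
have rpq : r < mdist p q by move: Qpq; rewrite mulrDl; lra.
(* The condition [C x] sits under the existential so that [choice] yields a total [f]; outside [C]
   its value is irrelevant. *)
have near x : exists y, C x -> Y y /\ mdist x y <= 3 * r.
  have [Cx|] := pselect (C x); last by exists x.
  have [y Yy xy] := near_of_quotient_close _ _ _ _ r0 rpq (rE _ _ Cp Cq)
    (rE _ _ Cx Cp).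
  by exists y.
have [f fP] := choice near.
have [s [sC ps psq]] := delta_connected_joined Cc Cp Cq.
(* Moving both endpoints costs at most [6 * r], which the summand [8 * r] absorbs. *)
have fpq : 9 / alpha * r < mdist (f p) (f q).
  have := metric_triangle p (f p) q; have := metric_triangle (f p) (f q) q.
  have [_ pfp] := fP _ Cp; have [_] := fP _ Cq; rewrite [mdist q _]metric_sym => qfq.
  by move: Qpq; rewrite mulrDl; lra.
have afpq : 9 * r < alpha * mdist (f p) (f q).
  by rewrite -ltr_pdivrMl// mulrA [_ * 9]mulrC.
exists (f p), (map f s); split.
- move=> y /=; rewrite -map_cons => /mapP[x xs ->].
  by have [] := fP _ (sC _ xs).
- rewrite /relative_chain last_map psq path_map.
  (* Each new step is at most [3 * r + r + 3 * r], below the [9 * r] of [afpq]. This holds only on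
     [C], hence the restriction to points of the chain. *)
  apply: (sub_in_path (P := mem (p :: s)) _ _ ps).
  + move=> x y xs ys /= xy.
    have [_ xfx] := fP _ (sC _ xs); have [_ yfy] := fP _ (sC _ ys).
    have := metric_triangle (f x) x (f y); have := metric_triangle x y (f y).
    by rewrite [mdist (f x) x]metric_sym; lra.
  + exact/allP.
- by rewrite /Defs.nondegenerate last_map psq -mdist_gt0; lra.
Qed.

Lemma uniformly_disconnected_of_light (Q beta : R) : 0 < Q -> light Q pi ->
  0 < beta -> beta < 1 / Q -> uniformly_disconnected beta Y.
Proof.
move=> Q0 piQ b0 bQ [x [s [sY xs nd]]].
pose D := mdist x (last x s); have D0 : 0 < D by rewrite mdist_gt0.
have YA : Y `<=` pi @^-1` [set pi x].
  move=> y Yy; apply/quotient_map_eq; right.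
  by split; apply: subset_closure => //; apply: sY; exact: mem_head.
have sA := subset_trans sY YA.
have Ax : (pi @^-1` [set pi x]) x by [].
have bD0 : 0 < beta * D by rewrite mulr_gt0.
have diam1 : (diam [set pi x] <= (beta * D)%:E)%E.
  by apply: diam_le => [|_ _ -> ->]; rewrite ?mdistxx ltW.
have := piQ _ _ bD0 diam1 _ (delta_component_joined _ _ _ Ax).
move=> /mdist_le_diam/(_ (chain_joined_refl Ax)).
(* By definition [xs] is already a [delta_chain] of step [beta * D]. *)
move=> /(_ _ (chain_joined_mem sA xs (mem_last x s))); rewrite -/D leNgt.
by rewrite mulrA gtr_pMl// mulrC -ltr_pdivlMr// bQ.
Qed.

End Quotient.

Theorem proposition5p13 (R : realType) (alpha : R) (X : metricType R)
    (Y : set X) :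
  0 < alpha -> alpha < 1 ->
  let pi := quotient_map (@closed_closure X Y) in
  (uniformly_disconnected alpha Y ->
     metric_lipschitz 1 pi /\ light (9 / alpha + 8) pi) /\
  (forall Q : R, 0 < Q -> metric_lipschitz 1 pi -> light Q pi ->
     forall beta : R, 0 < beta -> beta <= 1 -> beta < 1 / Q ->
     uniformly_disconnected beta Y).
Proof.
move=> a0 _ pi; split=> [udY|Q Q0 _ piQ beta b0 _ bQ].
  split; first exact: metric_lipschitz_quotient_map.
  exact: light_quotient_map.
exact: uniformly_disconnected_of_light piQ b0 bQ.
Qed.
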